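(* Assume that $A\in\mathbb{R}^{n\times n}$ is nonsingular and let $N\in\mathbb{R}^{n\times n}$ be such that $[A,N]=U\tilde U^T$ with $U,\tilde U\in\mathbb{R}^{n\times s}$. Let $C\in\mathbb{R}^{n\times r}$. Then $$N\cdot\mathbf{EK}_k^{\square}(A,C)\subseteq\mathbf{EK}_k^{\square}(A,(NC,U)).$$
   Context: $[A,N]:=AN-NA$. $(NC,U)$ is the $n\times(r+s)$ matrix obtained by placing $NC$ and $U$ next to each other. $k$ is a nonnegative integer. For $A\in\mathbb{R}^{n\times n}$ and $C\in\mathbb{R}^{n\times r}$ the block Krylov subspace is $$\mathbf{K}_k^{\square}(A,C):=\operatorname{span}\{p(A)Cw : p\in\mathbb{R}[x],\ \deg(p)\le k,\ w\in\mathbb{R}^r\},$$ and for invertible $A$ the extended block Krylov subspace is the sum of vector spaces $$\mathbf{EK}_k^{\square}(A,C):=\mathbf{K}_k^{\square}(A,C)+\mathbf{K}_k^{\square}(A^{-1},A^{-1}C).$$ For a subspace $\mathcal{S}\subseteq\mathbb{R}^n$, $N\cdot\mathcal{S}:=\{Nx : x\in\mathcal{S}\}$. *)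

(* Defs.v *)
From HB Require Import structures.
From mathcomp Require Import all_boot all_order all_algebra.
From mathcomp Require Import all_classical reals.
Set Implicit Arguments.
Unset Strict Implicit.
Unset Printing Implicit Defensive.
Import Order.TTheory GRing.Theory Num.Theory.
Local Open Scope classical_set_scope.
Local Open Scope ring_scope.

Definition mx_commutator (R : realType) (n : nat) (A N : 'M[R]_n) : 'M[R]_n :=
  A *m N - N *m A.

Definition lin_span (R : realType) (V : lmodType R) (S : set V) : set V :=
  [set x | exists (m : nat) (a : 'I_m -> R) (v : 'I_m -> V),
     (forall i, S (v i)) /\ x = \sum_(i < m) a i *: v i].

Definition subspace_add (R : realType) (V : lmodType R) (S T : set V) : set V :=
  [set x + y | x in S & y in T].

(* The dimension is written n.+1 because horner_mx, the evaluation of a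
   polynomial at a matrix, requires a nontrivial matrix ring. The condition
   deg p <= k reads size p <= k.+1, which also allows p = 0. *)
Definition block_krylov (R : realType) (n r : nat) (k : nat)
    (A : 'M[R]_n.+1) (C : 'M[R]_(n.+1, r)) : set 'cV[R]_n.+1 :=
  lin_span [set v | exists (p : {poly R}) (w : 'cV[R]_r),
     (size p <= k.+1)%N /\ v = horner_mx A p *m C *m w].

(* Meaningful for A \in unitmx only: invmx A is A when A is singular. *)
Definition ext_block_krylov (R : realType) (n r : nat) (k : nat)
    (A : 'M[R]_n.+1) (C : 'M[R]_(n.+1, r)) : set 'cV[R]_n.+1 :=
  subspace_add (block_krylov k A C)
               (block_krylov k (invmx A) (invmx A *m C)).

(* Main.v *)
(** Since [A N = N A + U Ut^T], pushing [N] to the right through a power of [A]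
    costs one vector of the range of [U] at each step, so [N (p(A) C w)] stays in
    the Krylov space of [(N C, U)] with no increase of degree.  The same holds
    for [A^-1], because [N A^-1 = A^-1 N + A^-1 U Ut^T A^-1]. *)
Require Import Defs.
From mathcomp Require Import all_boot all_order all_algebra.
From mathcomp Require Import all_classical reals.
Set Implicit Arguments.
Unset Strict Implicit.
Unset Printing Implicit Defensive.
Import Order.TTheory GRing.Theory Num.Theory.
Local Open Scope classical_set_scope.
Local Open Scope ring_scope.

Lemma sub_lin_span (R : realType) (V : lmodType R) (S : set V) :
  S `<=` lin_span S.
Proof.
move=> x Sx; exists 1%N, (fun=> 1), (fun=> x); split=> //.
by rewrite big_ord1 scale1r.
Qed.

Lemma lin_span0 (R : realType) (V : lmodType R) (S : set V) : lin_span S 0.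
Proof.
by exists 0%N, (fun=> 0), (fun=> 0); split=> [[]//|]; rewrite big_ord0.
Qed.

Lemma lin_spanD (R : realType) (V : lmodType R) (S : set V) (x y : V) :
  lin_span S x -> lin_span S y -> lin_span S (x + y).
Proof.
move=> [m [a [v [Sv ->]]]] [p [b [w [Sw ->]]]].
exists (m + p)%N,
  (fun i => match fintype.split i with inl j => a j | inr j => b j end),
  (fun i => match fintype.split i with inl j => v j | inr j => w j end).
split=> [i|]; first by case: (fintype.split i).
rewrite big_split_ord /=; congr (_ + _); apply: eq_bigr => i _.
  by rewrite -[lshift p i]/(unsplit (inl i)) unsplitK.
by rewrite -[rshift m i]/(unsplit (inr i)) unsplitK.
Qed.

Lemma lin_spanZ (R : realType) (V : lmodType R) (S : set V) (c : R) (x : V) :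
  lin_span S x -> lin_span S (c *: x).
Proof.
move=> [m [a [v [Sv ->]]]]; exists m, (fun i => c * a i), v; split=> //.
by rewrite scaler_sumr; apply: eq_bigr => i _; rewrite scalerA.
Qed.

(** Reduces a claim about the image of a Krylov space to its generators [p(A) C w]. *)
Lemma lin_span_linear (R : realType) (V W : lmodType R) (f : {linear V -> W})
    (S : set V) (T : set W) :
  (forall x, S x -> lin_span T (f x)) ->
  forall x, lin_span S x -> lin_span T (f x).
Proof.
move=> fST x [m [a [v [Sv ->]]]]; rewrite linear_sum /=.
elim/big_ind: _ => [|y z|i _]; [exact: lin_span0 | exact: lin_spanD |].
by rewrite linearZ; apply: lin_spanZ; apply: fST.
Qed.

Lemma block_krylov_range (R : realType) (n r k : nat)
    (A : 'M[R]_n.+1) (C : 'M[R]_(n.+1, r)) (w : 'cV[R]_r) :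
  block_krylov k A C (C *m w).
Proof.
apply: sub_lin_span; exists 1, w.
by rewrite size_poly1 rmorph1 mul1mx.
Qed.

Lemma block_krylovS (R : realType) (n r k : nat)
    (A : 'M[R]_n.+1) (C : 'M[R]_(n.+1, r)) (x : 'cV[R]_n.+1) :
  block_krylov k A C x -> block_krylov k.+1 A C (A *m x).
Proof.
apply: (@lin_span_linear _ _ _ (@mulmx R n.+1 n.+1 1 A)) => _ [p [w [sp ->]]].
apply: sub_lin_span; exists ('X * p), w; split.
  by rewrite (leq_trans (size_polyMleq _ _)) // size_polyX.
by rewrite rmorphM /= horner_mx_X !mulmxA.
Qed.

(** Kept abstract in [B] and [D] to serve both summands: [B = A] with [D = (NC, U)], and [B = A^-1]
    with [D = A^-1 (NC, U)]. The degree bound survives because each swap of [N] and [B] leaves an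
    error in the range of [D], which has degree 0. *)
Lemma mulmx_block_krylov (R : realType) (n r t k : nat) (N B : 'M[R]_n.+1)
    (C : 'M[R]_(n.+1, r)) (D : 'M[R]_(n.+1, t)) :
  (forall w : 'cV[R]_r, exists y : 'cV[R]_t, N *m C *m w = D *m y) ->
  (forall x : 'cV[R]_n.+1, exists y : 'cV[R]_t,
    N *m B *m x = B *m N *m x + D *m y) ->
  forall x, block_krylov k B C x -> block_krylov k B D (N *m x).
Proof.
move=> NC NB; apply: (@lin_span_linear _ _ _ (@mulmx R n.+1 n.+1 1 N)) => _ [p [w [sp ->]]].
rewrite -/(block_krylov k B D _) /=.
(* Horner induction with [k] general, since the induction hypothesis is applied one degree lower. *)
elim/poly_ind: p k sp => [|p c IHp] k sp.
  by rewrite rmorph0 !mul0mx mulmx0; apply: lin_span0.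
have -> : N *m (horner_mx B (p * 'X + c%:P) *m C *m w) =
    N *m B *m (horner_mx B p *m C *m w) + c *: (N *m C *m w).
  (* Commuting [p] and ['X] as polynomials puts [B] on the left of [p(B)], next to [N]. *)
  rewrite mulrC rmorphD rmorphM /= horner_mx_X horner_mx_C !mulmxDl mulmxDr.
  by rewrite mul_scalar_mx -scalemxAl -scalemxAr !mulmxA.
have [y ->] := NC w; apply: lin_spanD; last first.
  by apply: lin_spanZ; apply: block_krylov_range.
have [z ->] := NB (horner_mx B p *m C *m w).
apply: lin_spanD; last exact: block_krylov_range.
rewrite -mulmxA; move: sp; rewrite size_MXaddC.
case: ifP => [/andP[/eqP -> _] _|_].
  by rewrite rmorph0 !mul0mx !mulmx0; apply: lin_span0.
(* Now [size p <= k]. For positive [k], [N p(B) C w] lies one degree lower and the factor [B]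
   restores the degree; for [k = 0] there is no lower space, but [p] vanishes. *)
case: k => [|k] sp; last by apply: block_krylovS; apply: IHp.
have /eqP -> : p == 0 by rewrite -size_poly_eq0 -leqn0.
by rewrite rmorph0 !mul0mx !mulmx0; apply: lin_span0.
Qed.

Theorem theorem3p5 (R : realType) (n r s k : nat)
    (A N : 'M[R]_n.+1) (U Ut : 'M[R]_(n.+1, s)) (C : 'M[R]_(n.+1, r))
    (A_nonsingular : A \in unitmx)
    (comm_AN : mx_commutator A N = U *m Ut^T) :
  [set N *m x | x in ext_block_krylov k A C]
    `<=` ext_block_krylov k A (row_mx (N *m C) U).
Proof.
have NA : N *m A = A *m N - U *m Ut^T.
  by rewrite -comm_AN /mx_commutator opprB addrC subrK.
(* Obtained by multiplying the commutator by [A^-1] on both sides. *)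
have NAV : N *m invmx A = invmx A *m N + invmx A *m U *m Ut^T *m invmx A.
  rewrite -(mulmxA (invmx A) U) -comm_AN /mx_commutator mulmxBr mulmxBl.
  rewrite mulmxA mulVmx // mul1mx -2!mulmxA mulmxV // mulmx1.
  by rewrite addrC subrK.
move=> _ [_ [x Kx [y Ky <-]] <-]; rewrite mulmxDr.
exists (N *m x); last exists (N *m y) => //.
  apply: mulmx_block_krylov Kx => [w|v].
    by exists (col_mx w 0); rewrite mul_row_col mulmx0 addr0.
  (* The error term of [NA] is [- U Ut^T v], hence the sign and the zero in the [NC] block. *)
  exists (col_mx 0 (- (Ut^T *m v))).
  by rewrite mul_row_col mulmx0 add0r NA mulmxBl mulmxN !mulmxA.
apply: mulmx_block_krylov Ky => [w|v].
  (* Here the starting block is [A^-1 C], so [N] must already pass one [A^-1]; the resulting error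
     fills the [U] block. *)
  exists (col_mx w (Ut^T *m invmx A *m C *m w)).
  by rewrite -[RHS]mulmxA mul_row_col mulmxDr !mulmxA NAV !mulmxDl.
exists (col_mx 0 (Ut^T *m invmx A *m v)).
by rewrite -[X in _ = _ + X]mulmxA mul_row_col mulmx0 add0r NAV mulmxDl !mulmxA.
Qed.
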